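(* Let $\bar D_0^J:=-\partial_t+D_0^J$. The following hold. (1) (Testing case.) Assume $Q=0$. Then $\dim\mathcal H(\phi)=\operatorname{rank}(A)\le k<n$ for every $\phi\in(0,\infty)^n$. Consequently, $-\partial_t+\mathcal L_\phi$ does not satisfy Hörmander's condition. (2) Assume that $a_0,a_1,\dots,a_n$ are pairwise distinct and that for each $i\in\{1,\dots,n\}$ there is an $m\in\{0,\dots,n\}$, $m\neq i$, such that $q_{mi}>0$ and such that, for all $p,j\in\{0,\dots,n\}$, $q_{pj}>0$ and $a_p-a_j=a_m-a_i$ imply $j=i$. Then $$\dim\operatorname{Lie}\{\bar D_0^J,D_1,\dots,D_k\}(t,\phi)=n+1$$ for every $(t,\phi)\in\mathbb R\times(0,\infty)^n$, and thus $-\partial_t+\mathcal L_\phi$ satisfies Hörmander's condition. (3) Assume that for every $j\in\{1,\dots,n\}$ one has $q_{mj}=0$ for all $m\in\{0,\dots,n\}$ with $m\ne j$, and that $q_{j0}>0$ for at least one $j\in\{1,\dots,n\}$. Then $\mathcal H(\phi)=\operatorname{diag}(\phi)\,\operatorname{colsp}[A^T\mid\mathbf 1]$ for every $\phi\in(0,\infty)^n$. In particular, when $n=k+1$, $-\partial_t+\mathcal L_\phi$ satisfies Hörmander's condition if $\operatorname{rank}[A^T\mid\mathbf 1]=n$; if $n>k+1$, it does not satisfy Hörmander's condition.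
   Context: Let $1\le k<n$ be integers. Let $Q=(q_{ij})_{i,j=0}^n$ be a real matrix with $q_{ij}\ge0$ for $i\ne j$, $q_{ii}\le0$, and $\sum_{j=0}^nq_{ij}=0$ for every $i$. Let $\lambda_0,\dots,\lambda_n\in\mathbb R^k$ be pairwise distinct, with $\lambda_0$ a vertex of their convex hull. Put $a_i:=\lambda_i-\lambda_0$ for $0\le i\le n$ (so $a_0=0$), with components $a_{ir}$ ($1\le r\le k$); $A\in\mathbb R^{k\times n}$ is the matrix with columns $a_1,\dots,a_n$; $\Sigma_{ij}:=a_i\cdot a_j$; $\mathbf 1\in\mathbb R^n$ is the all-ones column, $[A^T\mid\mathbf 1]\in\mathbb R^{n\times(k+1)}$, and $\operatorname{colsp}$ denotes column space. For $\phi\in(0,\infty)^n$ let $\phi_0:=1$ and $y(\phi):=1+\sum_{i=1}^n\phi_i$. Define vector fields on $(0,\infty)^n$: $$D_r=\sum_{j=1}^na_{jr}\phi_j\,\partial_{\phi_j}\ (1\le r\le k),\qquad D_0=\sum_{j=1}^n\Big(\frac1{y(\phi)}\sum_{i=1}^n\Sigma_{ij}\phi_i\phi_j-\frac12\|a_j\|^2\phi_j\Big)\partial_{\phi_j},$$ $$J=\sum_{j=1}^n\sum_{i=0}^n(q_{ij}-q_{i0}\phi_j)\phi_i\,\partial_{\phi_j},\qquad D_0^J=D_0+J,\qquad \mathcal L_\phi=D_0^J+\frac12\sum_{r=1}^kD_r^2.$$ These are also regarded as vector fields on $\mathbb R\times(0,\infty)^n$ with zero $\partial_t$ component. A vector field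 $\sum f_i\partial_{\phi_i}$ is identified with $(f_1,\dots,f_n)$. Lie bracket: $[F,G]=FG-GF$. For smooth fields $F_0,\dots,F_k$, $\operatorname{Lie}\{F_0,\dots,F_k\}(p)$ is the linear span of the values at $p$ of the fields and of all their iterated Lie brackets; the operator $F_0+\frac12\sum_{r=1}^kF_r^2$ satisfies Hörmander's condition if this span is the whole tangent space at every point $p$ of the domain. $\mathcal H(\phi)$ is the linear span of the values at $\phi$ of all iterated Lie brackets of $D_0^J,D_1,\dots,D_k$ that contain at least one field $D_r$, $1\le r\le k$ (including the fields $D_r$ themselves). *)

(* Defs.v *)
From HB Require Import structures.
From mathcomp Require Import all_boot all_order all_algebra.
From mathcomp Require Import all_classical all_reals all_analysis.
Set Implicit Arguments.
Unset Strict Implicit.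
Unset Printing Implicit Defensive.
Import Order.TTheory GRing.Theory Num.Theory.
Import numFieldNormedType.Exports.
Local Open Scope classical_set_scope.
Local Open Scope ring_scope.

Lemma span_ex (R : realType) (V : vectType R) (S : set V) :
  exists U : {vspace V}, forall v : V, v \in U <->
    exists2 s : seq V, (forall x, x \in s -> S x) & v \in span s.
Proof.
pose P d := `[< exists2 s : seq V, (forall x, x \in s -> S x) & \dim (span s) = d >].
have P0 : exists d, P d by exists 0%N; apply/asboolP; exists [::]; rewrite ?span_nil ?dimv0.
have Pub d : P d -> (d <= \dim {:V})%N.
  by move=> /asboolP[s _ <-]; apply: dimvS; exact: subvf.
case: (ex_maxnP P0 Pub) => d /asboolP[s sS ds] dmax.
exists (span s) => v; split=> [vs|[s' s'S vs']]; first by exists s.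
have ss' : (span s <= span (s ++ s'))%VS by rewrite span_cat addvSl.
have /eqP -> : span s == span (s ++ s').
  rewrite eqEdim ss' ds; apply: dmax; apply/asboolP; exists (s ++ s') => //.
  by move=> x; rewrite mem_cat => /orP[/sS|/s'S].
by rewrite span_cat; exact: (subvP (addvSr _ _)).
Qed.

Definition lin_span (R : realType) (V : vectType R) (S : set V) : {vspace V} :=
  projT1 (cid (span_ex S)).

Lemma lin_spanP (R : realType) (V : vectType R) (S : set V) (v : V) :
  v \in lin_span S <->
  exists2 s : seq V, (forall x, x \in s -> S x) & v \in span s.
Proof. exact: (projT2 (cid (span_ex S))). Qed.

Definition conv_hull (R : realType) (V : lmodType R) (I : finType) (x : I -> V)
  : set V :=
  [set v | exists w : I -> R,
     [/\ forall i, 0 <= w i, \sum_i w i = 1 & v = \sum_i w i *: x i]].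

(* A vertex of a polytope, as an extreme point. *)
Definition is_vertex (R : realType) (V : lmodType R) (C : set V) (v : V) : Prop :=
  C v /\ forall (x y : V) (t : R), C x -> C y -> 0 < t < 1 ->
    v = t *: x + (1 - t) *: y -> x = v /\ y = v.

Definition colsp (R : realType) (m p : nat) (M : 'M[R]_(m, p)) : {vspace 'cV[R]_m} :=
  <<[seq col j M | j <- enum 'I_p]>>%VS.

(* The field [sum_i f_i d/dx_i] on (an open subset of) R^m is the function
   [f : 'cV_m -> 'cV_m].  Fields are total functions, but the values of iterated
   [vlie]s on an open set only depend on the generating fields on that set. *)

Definition vfield (R : realType) (m : nat) := 'cV[R]_m -> 'cV[R]_m.

Definition partial (R : realType) (m : nat) (i : 'I_m) (h : 'cV[R]_m -> R)
  : 'cV[R]_m -> R := fun x => 'D_(delta_mx i 0) h x.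

Definition vact (R : realType) (m : nat) (F : vfield R m) (h : 'cV[R]_m -> R)
  : 'cV[R]_m -> R := fun x => \sum_(i < m) F x i 0 * partial i h x.

(* The j-th component of FG - GF is its value on the j-th coordinate function;
   the second-order terms cancel. *)
Definition vlie (R : realType) (m : nat) (F G : vfield R m) : vfield R m :=
  fun x => \col_j (vact F (fun z => G z j 0) x - vact G (fun z => F z j 0) x).

(* Iterated brackets of F_0, ..., F_k are indexed by binary trees: [None] stands
   for the drift F_0 and [Some r] for the r-th of the remaining k fields. *)
Inductive lie_word (k : nat) : Type :=
| LieGen of option 'I_k
| LieBr of lie_word k & lie_word k.

Fixpoint lie_eval (R : realType) (m k : nat) (F0 : vfield R m)
    (F : 'I_k -> vfield R m) (w : lie_word k) : vfield R m :=
  match w with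
  | LieGen None => F0
  | LieGen (Some r) => F r
  | LieBr u v => vlie (lie_eval F0 F u) (lie_eval F0 F v)
  end.

Fixpoint has_diffusion (k : nat) (w : lie_word k) : bool :=
  match w with
  | LieGen o => isSome o
  | LieBr u v => has_diffusion u || has_diffusion v
  end.

Definition Lie_span (R : realType) (m k : nat) (F0 : vfield R m)
    (F : 'I_k -> vfield R m) (p : 'cV[R]_m) : {vspace 'cV[R]_m} :=
  lin_span [set lie_eval F0 F w p | w in [set: lie_word k]].

Definition Lie_ideal_span (R : realType) (m k : nat) (F0 : vfield R m)
    (F : 'I_k -> vfield R m) (p : 'cV[R]_m) : {vspace 'cV[R]_m} :=
  lin_span [set lie_eval F0 F w p | w in [set w : lie_word k | has_diffusion w]].

(* The operator F_0 + 1/2 sum_r F_r^2, presented by its fields. *)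
Record hop (R : realType) (m k : nat) : Type :=
  Hop { drift : vfield R m; diffusion : 'I_k -> vfield R m }.

Definition hop_act (R : realType) (m k : nat) (L : hop R m k)
    (u : 'cV[R]_m -> R) : 'cV[R]_m -> R :=
  fun x => vact (drift L) u x
    + 2^-1 * \sum_(r < k) vact (diffusion L r) (vact (diffusion L r) u) x.

Definition hormander (R : realType) (m k : nat) (dom : set 'cV[R]_m)
    (L : hop R m k) : Prop :=
  forall p, dom p -> Lie_span (drift L) (diffusion L) p = fullv.

(* R x R^n is represented by ['cV_(1 + n)], time coming first. *)

Definition tpoint (R : realType) (n : nat) (t : R) (x : 'cV[R]_n)
  : 'cV[R]_(1 + n) := col_mx t%:M x.

Definition tlift (R : realType) (n : nat) (F : vfield R n) : vfield R (1 + n) :=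
  fun p => col_mx 0 (F (dsubmx p)).

Definition ddt (R : realType) (n : nat) : vfield R (1 + n) :=
  fun _ => col_mx 1%:M 0.

Definition tbar (R : realType) (n : nat) (F : vfield R n) : vfield R (1 + n) :=
  fun p => - ddt p + tlift F p.

Definition minus_dt_plus (R : realType) (n k : nat) (L : hop R n k)
  : hop R (1 + n) k :=
  Hop (tbar (drift L)) (fun r => tlift (diffusion L r)).

Lemma vact_tlift (R : realType) (n : nat) (F : vfield R n)
    (u : 'cV[R]_(1 + n) -> R) (t : R) (x : 'cV[R]_n) :
  vact (tlift F) u (tpoint t x) = vact F (fun z => u (tpoint t z)) x.
Proof.
rewrite /vact big_split_ord /= big1 ?add0r => [|i _]; last first.
  by rewrite /tlift col_mxEu mxE mul0r.
apply: eq_bigr => i _; rewrite /tlift col_mxEd /tpoint col_mxKd; congr (_ * _).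
rewrite /partial /derive.
suff -> : (fun h : R => h^-1 *: ((u \o shift (col_mx t%:M x))
              (h *: delta_mx (rshift 1 i) 0) - u (col_mx t%:M x))) =
          (fun h : R => h^-1 *: (((fun z => u (col_mx t%:M z)) \o shift x)
              (h *: delta_mx i 0) - u (col_mx t%:M x))) by [].
apply/funext => h /=.
congr (_ *: (u _ - _)).
apply/matrixP => a b; rewrite !ord1 {b}.
case: (split_ordP a) => j ->.
  rewrite !mxE (unsplitK (inl j)) !mxE eq_lrshift.
  by rewrite /= mulr0 add0r.
rewrite !mxE (unsplitK (inr j)) !mxE eq_rshift.
by [].
Qed.

(* [minus_dt_plus L] does denote -d/dt + L. *)
Lemma hop_act_minus_dt_plus (R : realType) (n k : nat) (L : hop R n k)
    (u : 'cV[R]_(1 + n) -> R) (t : R) (x : 'cV[R]_n) :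
  hop_act (minus_dt_plus L) u (tpoint t x) =
  - partial ord0 u (tpoint t x) + hop_act L (fun z => u (tpoint t z)) x.
Proof.
rewrite /hop_act addrA; congr (_ + _ * _); last first.
  apply: eq_bigr => r _; rewrite /= vact_tlift; congr (vact _ _ _).
  by apply/funext => z; exact: vact_tlift.
rewrite -vact_tlift /= /tbar /vact.
under eq_bigr do rewrite 2!mxE mulrDl.
rewrite big_split /=; congr (_ + _).
rewrite big_split_ord /= [X in _ + X]big1 ?addr0 => [|i _]; last first.
  by rewrite /ddt col_mxEd mxE oppr0 mul0r.
rewrite big_ord1 /ddt col_mxEu mxE mulN1r; congr (- partial _ _ _).
Qed.

(* Indices 0, ..., n live in ['I_n.+1]; the index j in {1, ..., n} that
   corresponds to [j : 'I_n] is [lift ord0 j]. *)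

Definition pos_orthant (R : realType) (n : nat) : set 'cV[R]_n :=
  [set phi | forall j, 0 < phi j 0].

Definition time_domain (R : realType) (n : nat) : set 'cV[R]_(1 + n) :=
  [set tpoint t phi | t in [set: R] & phi in @pos_orthant R n].

Arguments pos_orthant : clear implicits.
Arguments time_domain : clear implicits.

Definition generator (R : realType) (n : nat) (q : 'M[R]_n.+1) : Prop :=
  [/\ forall i j, i != j -> 0 <= q i j,
      forall i, q i i <= 0 & forall i, \sum_j q i j = 0].

Definition shifted (R : realType) (n k : nat) (lam : 'I_n.+1 -> 'cV[R]_k)
  (i : 'I_n.+1) : 'cV[R]_k := lam i - lam ord0.

Definition dotv (R : realType) (k : nat) (u v : 'cV[R]_k) : R :=
  \sum_(r < k) u r 0 * v r 0.

Definition Amx (R : realType) (n k : nat) (lam : 'I_n.+1 -> 'cV[R]_k) : 'M[R]_(k, n) :=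
  \matrix_(r < k, j < n) shifted lam (lift ord0 j) r 0.

Definition AT1 (R : realType) (n k : nat) (lam : 'I_n.+1 -> 'cV[R]_k)
  : 'M[R]_(n, k + 1) := row_mx (Amx lam)^T (const_mx 1).

Definition Sigma (R : realType) (n k : nat) (lam : 'I_n.+1 -> 'cV[R]_k)
  (i j : 'I_n.+1) : R := dotv (shifted lam i) (shifted lam j).

(* phi_i for 0 <= i <= n, with phi_0 = 1. *)
Definition ext (R : realType) (n : nat) (phi : 'cV[R]_n) (i : 'I_n.+1) : R :=
  if unlift ord0 i is Some j then phi j 0 else 1.

Definition ysum (R : realType) (n : nat) (phi : 'cV[R]_n) : R :=
  1 + \sum_(i < n) phi i 0.

Definition Dfield (R : realType) (n k : nat) (lam : 'I_n.+1 -> 'cV[R]_k)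
    (r : 'I_k) : vfield R n :=
  fun phi => \col_j (shifted lam (lift ord0 j) r 0 * phi j 0).

Definition D0field (R : realType) (n k : nat) (lam : 'I_n.+1 -> 'cV[R]_k)
  : vfield R n :=
  fun phi => \col_j
    ((ysum phi)^-1 *
       (\sum_(i < n) Sigma lam (lift ord0 i) (lift ord0 j) * phi i 0 * phi j 0)
     - 2^-1 * dotv (shifted lam (lift ord0 j)) (shifted lam (lift ord0 j)) * phi j 0).

Definition Jfield (R : realType) (n : nat) (q : 'M[R]_n.+1) : vfield R n :=
  fun phi => \col_j
    \sum_(i < n.+1) (q i (lift ord0 j) - q i ord0 * phi j 0) * ext phi i.

Definition D0Jfield (R : realType) (n k : nat) (q : 'M[R]_n.+1)
    (lam : 'I_n.+1 -> 'cV[R]_k) : vfield R n :=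
  fun phi => D0field lam phi + Jfield q phi.

Definition Lphi (R : realType) (n k : nat) (q : 'M[R]_n.+1)
    (lam : 'I_n.+1 -> 'cV[R]_k) : hop R n k :=
  Hop (D0Jfield q lam) (Dfield lam).

Definition Hspace (R : realType) (n k : nat) (q : 'M[R]_n.+1)
    (lam : 'I_n.+1 -> 'cV[R]_k) (phi : 'cV[R]_n) : {vspace 'cV[R]_n} :=
  Lie_ideal_span (D0Jfield q lam) (Dfield lam) phi.

Definition diagv (R : realType) (n : nat) (phi : 'cV[R]_n)
  : 'Hom('cV[R]_n, 'cV[R]_n) := linfun (mulmx (diag_mx phi^T)).

(* Main.v *)
Require Import Defs.
From HB Require Import structures.
From mathcomp Require Import all_boot all_order all_algebra.
From mathcomp Require Import all_classical all_reals all_analysis.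
From mathcomp Require Import ring.
Set Implicit Arguments.
Unset Strict Implicit.
Unset Printing Implicit Defensive.
Import Order.TTheory GRing.Theory Num.Theory.
Import numFieldNormedType.Exports.
Local Open Scope classical_set_scope.
Local Open Scope ring_scope.

(* In the commuting frame phi_j d/dphi_j the bracket only differentiates
   coefficients: each D_r has constant coefficients, and D_0 is, up to a field
   with constant coefficients, a combination of the D_r with smooth
   coefficients.  So if the drift lies in a constant-coefficient distribution up
   to such a field, all brackets stay in that distribution; this bounds H from
   above in (1) and (3).  From below, J is the sum of the weight vectors
   q_pj phi_p d/dphi_j for ad(D_1), ..., ad(D_k), of weight a_p - a_j (with
   - phi_p times the Euler field when j = 0).  Hence, modulo the D_r, iterated
   ad(D_r) of the drift isolates every single nonzero weight.  Finally, adding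
   the time variable adds exactly one dimension to H. *)

(** * Smooth functions on the positive orthant *)

(** A syntactic substitute for C^infinity: large enough for the rational coefficients that occur
    here, and closed under partial derivatives. *)
Inductive smooth (R : realType) (n : nat) : ('cV[R]_n -> R) -> Prop :=
| SmoothCst c : smooth (fun _ => c)
| SmoothCoord j : smooth (fun x => x j 0)
| SmoothD f g of smooth f & smooth g : smooth (fun x => f x + g x)
| SmoothM f g of smooth f & smooth g : smooth (fun x => f x * g x)
| SmoothV f of smooth f & (forall x, pos_orthant R n x -> f x != 0) :
    smooth (fun x => (f x)^-1).

Lemma near_pos_orthant (R : realType) (n : nat) (x : 'cV[R]_n) :
  pos_orthant R n x -> \forall z \near x, pos_orthant R n z.
Proof.
move=> xpos; apply: (@filter_forall _ 'I_n (fun j z => 0 < z j 0) (nbhs x)) => j.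
have cx : (fun z : 'cV[R]_n => z j 0) @ x --> x j 0 by exact: coord_continuous.
exact: cx (lt_nbhsr (xpos j)).
Qed.

Lemma is_derive_coord (R : realType) (n : nat) (x v : 'cV[R]_n) (j : 'I_n) :
  is_derive x v (fun z : 'cV[R]_n => z j 0) (v j 0).
Proof.
have cv : (fun h : R => h^-1 *:
    (((fun z : 'cV[R]_n => z j 0) \o shift x) (h *: v) - x j 0))
   @ 0^' --> v j 0.
  apply: cvg_near_cst; near=> h.
  rewrite /= !mxE addrK [_ *: _]mulKf //; near: h; exact: nbhs_dnbhs_neq.
by split; [apply/cvg_ex; exists (v j 0) | exact: (cvg_lim _ cv)].
Unshelve. all: by end_near. Qed.

Lemma smooth_sum (R : realType) (n : nat) (I : Type) (s : seq I)
    (f : I -> 'cV[R]_n -> R) :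
  (forall i, smooth (f i)) -> smooth (fun x => \sum_(i <- s) f i x).
Proof.
move=> fS; elim: s => [|i s IH].
  rewrite (_ : (fun _ => _) = fun _ => 0); first exact: SmoothCst.
  by apply/funext => x; rewrite big_nil.
rewrite (_ : (fun _ => _) = fun x => f i x + \sum_(j <- s) f j x).
  exact: SmoothD.
by apply/funext => x; rewrite big_cons.
Qed.

(** The derivative is produced inside the same class, so differentiation can be iterated along
    nested brackets. Only the orthant matters, since inverted functions may vanish outside it. *)
Lemma smooth_is_derive (R : realType) (n : nat) (f : 'cV[R]_n -> R) (i : 'I_n) :
  smooth f -> exists2 g, smooth g &
    forall x, pos_orthant R n x -> is_derive x (delta_mx i 0) f (g x).
Proof.
elim=> {f} [c|j|f g _ [f' f'S df] _ [g' g'S dg]|f g fS [f' f'S df] gS [g' g'S dg]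
  |f fS [f' f'S df] f0].
- exists (fun=> 0); first exact: SmoothCst.
  by move=> x _; exact: is_derive_cst.
- exists (fun=> (delta_mx i 0 : 'cV[R]_n) j 0); first exact: SmoothCst.
  by move=> x _; exact: is_derive_coord.
- exists (fun x => f' x + g' x); first exact: SmoothD.
  by move=> x xp; apply: is_deriveD; [exact: df|exact: dg].
- exists (fun x => f x * g' x + g x * f' x).
    by apply: SmoothD; apply: SmoothM.
  by move=> x xp; apply: is_deriveM; [exact: df|exact: dg].
exists (fun x => (-1) * ((f x)^-1 * (f x)^-1) * f' x).
  by apply: SmoothM => //; apply: SmoothM; [exact: SmoothCst|]; apply: SmoothM; exact: SmoothV.
move=> x xp; have [dfx fE] := df x xp.
split; first by apply: derivableV => //; exact: f0.
by rewrite deriveV ?f0 // fE -[_ *: _]/(_ * _) expr2 invfM mulN1r.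
Qed.

Lemma smooth_derivable (R : realType) (n : nat) (f : 'cV[R]_n -> R) (i : 'I_n)
    (x : 'cV[R]_n) :
  smooth f -> pos_orthant R n x -> derivable f x (delta_mx i 0).
Proof. by move=> /(smooth_is_derive i)[g _ df] /df[]. Qed.

Lemma eq_partial (R : realType) (n : nat) (f g : 'cV[R]_n -> R) (i : 'I_n)
    (x : 'cV[R]_n) :
  pos_orthant R n x -> (forall z, pos_orthant R n z -> f z = g z) ->
  partial i f x = partial i g x.
Proof.
move=> xp fg; apply: near_eq_derive.
by apply: filterS (near_pos_orthant xp) => z /fg.
Qed.

Lemma partial_sumZ (R : realType) (n : nat) (I : Type) (s : seq I) (c : I -> R)
    (f : I -> 'cV[R]_n -> R) (d : R) (i : 'I_n) (x : 'cV[R]_n) :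
  pos_orthant R n x -> (forall a, smooth (f a)) ->
  partial i (fun z => \sum_(a <- s) c a * f a z + d) x =
  \sum_(a <- s) c a * partial i (f a) x.
Proof.
move=> xp fS; rewrite -[RHS]addr0.
apply: derive_val; apply: is_deriveD.
rewrite (_ : (fun _ => _) = \sum_(a <- s) (c a \*: f a)); last first.
  by apply/funext => z; rewrite fct_sumE.
elim: s => [|a s IH]; first by rewrite !big_nil; exact: is_derive_cst.
rewrite !big_cons; apply: is_deriveD IH; apply: is_deriveZ.
exact/derivableP/smooth_derivable.
Qed.

Lemma partial_mulcoord (R : realType) (n : nat) (f : 'cV[R]_n -> R) (i j : 'I_n)
    (x : 'cV[R]_n) :
  pos_orthant R n x -> smooth f ->
  partial i (fun z => z j 0 * f z) x = (j == i)%:R * f x + x j 0 * partial i f x.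
Proof.
move=> xp fS; apply: derive_val.
have df : is_derive x (delta_mx i 0) f (partial i f x).
  exact/derivableP/smooth_derivable.
have := is_deriveM (is_derive_coord x (delta_mx i 0) j) df.
by move=> /is_derive_eq; apply; rewrite !mxE eqxx andbT addrC mulrC.
Qed.

(** * Derivation along fields, and brackets in the frame x_j d/dx_j *)

Lemma vact_const (R : realType) (n : nat) (F : vfield R n) (c : R)
    (x : 'cV[R]_n) : vact F (fun _ => c) x = 0.
Proof.
by rewrite /vact big1 // => i _; rewrite /partial (derive_cst c) mulr0.
Qed.

Lemma vactD (R : realType) (n : nat) (F : vfield R n) (f g : 'cV[R]_n -> R)
    (x : 'cV[R]_n) : pos_orthant R n x -> smooth f -> smooth g ->
  vact F (fun z => f z + g z) x = vact F f x + vact F g x.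
Proof.
move=> xp fS gS; rewrite /vact -big_split; apply: eq_bigr => i _ /=.
by rewrite -mulrDr /partial deriveD //; exact: smooth_derivable.
Qed.

Lemma vact_sumZ (R : realType) (n : nat) (F : vfield R n) (I : Type) (s : seq I)
    (c : I -> R) (f : I -> 'cV[R]_n -> R) (d : R) (x : 'cV[R]_n) :
  pos_orthant R n x -> (forall a, smooth (f a)) ->
  vact F (fun z => \sum_(a <- s) c a * f a z + d) x =
  \sum_(a <- s) c a * vact F (f a) x.
Proof.
move=> xp fS; under [RHS]eq_bigr do rewrite mulr_sumr.
rewrite exchange_big; apply: eq_bigr => i _ /=.
rewrite partial_sumZ // mulr_sumr; apply: eq_bigr => a _.
by rewrite mulrCA.
Qed.

Lemma eq_vact (R : realType) (n : nat) (F G : vfield R n) (f g : 'cV[R]_n -> R)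
    (x : 'cV[R]_n) : pos_orthant R n x ->
  (forall z, pos_orthant R n z -> F z = G z) ->
  (forall z, pos_orthant R n z -> f z = g z) -> vact F f x = vact G g x.
Proof.
move=> xp FG fg; apply: eq_bigr => i _.
by rewrite FG // (eq_partial _ xp fg).
Qed.

Definition smooth_field (R : realType) (n : nat) (F : vfield R n) : Prop :=
  forall i, exists2 f, smooth f & forall x, pos_orthant R n x -> F x i 0 = f x.

Lemma smooth_vact (R : realType) (n : nat) (F : vfield R n) (h : 'cV[R]_n -> R) :
  smooth_field F -> smooth h ->
  exists2 g, smooth g & forall x, pos_orthant R n x -> vact F h x = g x.
Proof.
move=> FS hS.
pose f i := projT1 (cid2 (FS i)).
have fS i : smooth (f i) by rewrite /f; case: cid2.
have FE i x : pos_orthant R n x -> F x i 0 = f i x.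
  by rewrite /f; case: cid2 => /= g _; exact.
pose h' i := projT1 (cid2 (smooth_is_derive i hS)).
have h'S i : smooth (h' i) by rewrite /h'; case: cid2.
have hE i x : pos_orthant R n x -> partial i h x = h' i x.
  by rewrite /h'; case: cid2 => /= g _ dh xp; have [_ <-] := dh x xp.
exists (fun x => \sum_i f i x * h' i x).
  by apply: smooth_sum => i; exact: SmoothM.
by move=> x xp; apply: eq_bigr => i _; rewrite FE // hE.
Qed.

(* The frame [x_j d/dx_j] commutes, so brackets only differentiate the
   coefficients [f], [g] of the fields in this frame. *)
Lemma vlie_frame (R : realType) (n : nat) (F G : vfield R n)
    (f g : 'I_n -> 'cV[R]_n -> R) (x : 'cV[R]_n) (j : 'I_n) :
  (forall i, smooth (f i)) -> (forall i, smooth (g i)) ->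
  (forall z i, pos_orthant R n z -> F z i 0 = z i 0 * f i z) ->
  (forall z i, pos_orthant R n z -> G z i 0 = z i 0 * g i z) ->
  pos_orthant R n x ->
  vlie F G x j 0 = x j 0 * (vact F (g j) x - vact G (f j) x).
Proof.
move=> fS gS FE GE xp.
(* Leibniz rule on x_j h_j. The term in which x_j is differentiated equals x_j f_j g_j for both
   orders of the fields, so it cancels in the bracket. *)
have vactE (H1 H2 : vfield R n) (h : 'I_n -> 'cV[R]_n -> R) :
    (forall i, smooth (h i)) ->
    (forall z i, pos_orthant R n z -> H2 z i 0 = z i 0 * h i z) ->
    vact H1 (fun z => H2 z j 0) x = H1 x j 0 * h j x + x j 0 * vact H1 (h j) x.
  move=> hS HE.
  rewrite (@eq_vact _ _ H1 H1 _ (fun z => z j 0 * h j z)) // /vact => [|z /HE//].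
  rewrite mulr_sumr (eq_bigr (fun i => H1 x i 0 * (j == i)%:R * h j x +
      x j 0 * (H1 x i 0 * partial i (h j) x))); last first.
    by move=> i _; rewrite partial_mulcoord // mulrDr mulrA mulrCA.
  rewrite big_split /=; congr (_ + _).
  rewrite (bigD1 j) //= eqxx mulr1 big1 ?addr0 // => i /negPf ij.
  by rewrite eq_sym ij mulr0 mul0r.
rewrite mxE (vactE F G g) // (vactE G F f) // FE // GE //; ring.
Qed.

(** * Distributions with constant coefficients in the frame *)

(** The frame coefficients of [F] lie in the column space of [M], up to a multiple of the fixed
    vector [e]. The factor [d] is a number, not a function, so that brackets annihilate this extra
    part. *)
Definition spanned (R : realType) (n p : nat) (M : 'M[R]_(n, p)) (e : 'I_n -> R)
    (d : R) (F : vfield R n) : Prop :=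
  exists2 f : 'I_p -> 'cV[R]_n -> R, forall s, smooth (f s) &
    forall x j, pos_orthant R n x ->
      F x j 0 = x j 0 * (\sum_s M j s * f s x + d * e j).

Lemma smooth_lincomb (R : realType) (n : nat) (I : Type) (s : seq I) (c : I -> R)
    (f : I -> 'cV[R]_n -> R) :
  (forall a, smooth (f a)) -> smooth (fun x => \sum_(a <- s) c a * f a x).
Proof.
by move=> fS; apply: smooth_sum => a; apply: SmoothM => //; exact: SmoothCst.
Qed.

Lemma frame_smooth_field (R : realType) (n : nat) (F : vfield R n)
    (f : 'I_n -> 'cV[R]_n -> R) :
  (forall i, smooth (f i)) ->
  (forall z i, pos_orthant R n z -> F z i 0 = z i 0 * f i z) -> smooth_field F.
Proof.
move=> fS FE i; exists (fun x : 'cV[R]_n => x i 0 * f i x) => [|x xp]; last exact: FE.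
by apply: SmoothM => //; exact: SmoothCoord.
Qed.

(** Brackets only differentiate frame coefficients: the constant columns of [M] come out of the
    derivatives, and the constant terms [d * e j] and [d' * e j] disappear. *)
Lemma spanned_vlie (R : realType) (n p : nat) (M : 'M[R]_(n, p)) (e : 'I_n -> R)
    (d d' : R) (F G : vfield R n) :
  spanned M e d F -> spanned M e d' G -> spanned M e 0 (vlie F G).
Proof.
move=> [f fS FE] [g gS GE].
have coefS (h : 'I_p -> 'cV[R]_n -> R) (c : R) : (forall s, smooth (h s)) ->
    forall j : 'I_n, smooth (fun x => \sum_s M j s * h s x + c * e j).
  by move=> hS j; apply: SmoothD (SmoothCst _ _); exact: smooth_lincomb.
have FS : smooth_field F.
  by apply: frame_smooth_field (coefS f d fS) _ => z i; exact: FE.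
have GS : smooth_field G.
  by apply: frame_smooth_field (coefS g d' gS) _ => z i; exact: GE.
have /choice[h hP] s : exists h, smooth h /\
    forall x, pos_orthant R n x -> vact F (g s) x - vact G (f s) x = h x.
  have [h1 h1S h1E] := smooth_vact FS (gS s).
  have [h2 h2S h2E] := smooth_vact GS (fS s).
  exists (fun x => h1 x + -1 * h2 x); split.
    by apply: SmoothD => //; apply: SmoothM => //; exact: SmoothCst.
  by move=> x xp; rewrite h1E // h2E // mulN1r.
exists h => [s|x j xp]; first by have [] := hP s.
rewrite (vlie_frame _ (coefS f d fS) (coefS g d' gS)) //.
rewrite !vact_sumZ // -sumrB mul0r addr0; congr (_ * _); apply: eq_bigr => s _.
by have [_ <-] := hP s; rewrite // mulrBr.
Qed.

(** A multiple of [e] survives only at a leaf, and among the leaves only the drift carries one. *)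
Lemma spanned_lie_eval (R : realType) (n k p : nat) (M : 'M[R]_(n, p))
    (e : 'I_n -> R) (F0 : vfield R n) (F : 'I_k -> vfield R n) (w : lie_word k) :
  spanned M e 1 F0 -> (forall r, spanned M e 0 (F r)) ->
  exists2 d, spanned M e d (lie_eval F0 F w) & (has_diffusion w -> d = 0).
Proof.
move=> F0M FM; elim: w => [[r|]|u [d ud _] v [d' vd _]] /=.
- by exists 0; first exact: FM.
- by exists 1.
by exists 0; first exact: spanned_vlie ud vd.
Qed.

(** * Iterated brackets of the diffusion fields with the drift *)

Definition ad_word (k : nat) (rs : seq 'I_k) : lie_word k :=
  foldr (fun r w => LieBr (LieGen (Some r)) w) (LieGen None) rs.

Lemma has_diffusion_ad (k : nat) (rs : seq 'I_k) :
  rs != [::] -> has_diffusion (ad_word rs).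
Proof. by case: rs. Qed.

(** Each [F r] has constant frame coefficients, so bracketing with it is differentiation along it:
    the eigenfunction [u i] is scaled by its weight, [e] drops out at the first bracket, and the
    part along the columns of [M] keeps its form with new coefficients [g]. *)
Lemma lie_eval_ad (R : realType) (n k : nat) (I : finType) (M : 'M[R]_(n, k))
    (e : 'I_n -> R) (u : I -> 'I_n -> 'cV[R]_n -> R) (weight : 'I_k -> I -> R)
    (c : I -> R) (f : 'I_k -> 'cV[R]_n -> R)
    (F0 : vfield R n) (F : 'I_k -> vfield R n) :
  (forall i j, smooth (u i j)) -> (forall s, smooth (f s)) ->
  (forall x j, pos_orthant R n x -> F0 x j 0 = x j 0 *
     (\sum_s M j s * f s x + (\sum_i c i * u i j x + e j))) ->
  (forall r x j, pos_orthant R n x -> F r x j 0 = x j 0 * M j r) ->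
  (forall r i j x, pos_orthant R n x ->
     vact (F r) (u i j) x = weight r i * u i j x) ->
  forall rs, exists2 g : 'I_k -> 'cV[R]_n -> R, forall s, smooth (g s) &
    forall x j, pos_orthant R n x -> lie_eval F0 F (ad_word rs) x j 0 = x j 0 *
      (\sum_s M j s * g s x +
        (\sum_i c i * \prod_(r <- rs) weight r i * u i j x +
         (rs == [::])%:R * e j)).
Proof.
move=> uS fS F0E FE uw; elim=> [|r rs [g gS gE]].
  exists f => // x j xp; rewrite F0E // eqxx mul1r.
  by under [X in _ = _ * (_ + (X + _))]eq_bigr do rewrite big_nil mulr1.
have FrS : smooth_field (F r).
  apply: (@frame_smooth_field _ _ _ (fun j _ => M j r)) => [j|z i].
    exact: SmoothCst.
  exact: FE.
have /choice[h hP] s : exists h, smooth h /\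
    forall x, pos_orthant R n x -> vact (F r) (g s) x = h x.
  by have [h hS hE] := smooth_vact FrS (gS s); exists h.
exists h => [s|x j xp]; first by have [] := hP s.
set W : lie_word k := ad_word rs in gE *.
have M1S i : smooth (fun x => \sum_s M i s * g s x) by exact: smooth_lincomb.
have M2S i : smooth (fun x => \sum_a c a * \prod_(r <- rs) weight r a * u a i x +
    (rs == [::])%:R * e i).
  by apply: SmoothD (SmoothCst _ _); exact: smooth_lincomb.
rewrite [LHS](@vlie_frame _ _ _ _ (fun i _ => M i r) _ x j _ _ _ gE) //.
- congr (_ * _); rewrite vact_const subr0 vactD // mul0r addr0; congr (_ + _).
    rewrite (_ : (fun z => _) = fun z => \sum_s M j s * g s z + 0); last first.
      by apply/funext => z; rewrite addr0.
    rewrite vact_sumZ //; apply: eq_bigr => s _; congr (_ * _).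
    by have [_ ->] := hP s.
  rewrite vact_sumZ //; apply: eq_bigr => a _.
  by rewrite uw // big_cons; ring.
- by move=> i; exact: SmoothCst.
- by move=> i; apply: SmoothD.
- by move=> z i; exact: FE.
Qed.

(** * Linear spans and column spaces *)

Lemma mem_lin_span (R : realType) (V : vectType R) (S : set V) (v : V) :
  S v -> v \in lin_span S.
Proof.
move=> Sv; apply/lin_spanP; exists [:: v]; last by rewrite memv_span ?mem_head.
by move=> x; rewrite inE => /eqP ->.
Qed.

Lemma lin_span_sub (R : realType) (V : vectType R) (S : set V) (U : {vspace V}) :
  (forall v, S v -> v \in U) -> (lin_span S <= U)%VS.
Proof.
move=> SU; apply/subvP => v /lin_spanP[s sS]; apply: subvP.
by apply/span_subvP => x /sS /SU.
Qed.

Lemma colsp_limg (R : realType) (m p : nat) (M : 'M[R]_(m, p)) :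
  colsp M = limg (linfun (mulmx M) : 'Hom('cV[R]_p, 'cV[R]_m)).
Proof.
apply/eqP; rewrite eqEsubv; apply/andP; split.
  apply/span_subvP => v /mapP[j _ ->].
  by apply/memv_imgP; exists (delta_mx j 0); rewrite ?memvf // lfunE colE.
apply/subvP => v /memv_imgP[u _ ->]; rewrite lfunE /=.
rewrite (_ : M *m u = \sum_j u j 0 *: col j M); last first.
  apply/colP => i; rewrite mxE summxE; apply: eq_bigr => j _.
  by rewrite !mxE mulrC.
apply: memv_suml => j _; apply/memvZ/memv_span.
by apply/mapP; exists j; rewrite ?mem_enum.
Qed.

Lemma mem_colsp (R : realType) (m p : nat) (M : 'M[R]_(m, p)) (u : 'cV[R]_p) :
  M *m u \in colsp M.
Proof.
by rewrite colsp_limg; apply/memv_imgP; exists u; rewrite ?memvf // lfunE.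
Qed.

(** The factor [col_base M] of the full rank factorization has the same column space, trivial kernel
    and [\rank M] columns. *)
Lemma dim_colsp (R : realType) (m p : nat) (M : 'M[R]_(m, p)) :
  \dim (colsp M) = \rank M.
Proof.
have -> : colsp M = colsp (col_base M).
  apply/eqP; rewrite eqEsubv; apply/andP; split;
    rewrite [colsp _ in X in (X <= _)%VS]colsp_limg;
    apply/subvP => v /memv_imgP[u _ ->]; rewrite lfunE /=.
    by rewrite -{1}(mulmx_base M) -mulmxA mem_colsp.
  have /row_freeP[B BE] := row_base_free M.
  by rewrite -[col_base M]mulmx1 -BE mulmxA mulmx_base -mulmxA mem_colsp.
rewrite colsp_limg limg_dim_eq; first by rewrite dimvf /dim /= muln1.
apply/eqP; rewrite -subv0; apply/subvP => u /memv_capP[_].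
have /row_fullP[B BE] := col_base_full M.
rewrite memv_ker lfunE /= => /eqP Cu0.
by rewrite -[u]mul1mx -BE -mulmxA Cu0 mulmx0 mem0v.
Qed.

(** * Adding the time variable *)

Lemma vlie0l (R : realType) (m : nat) (G : vfield R m) :
  vlie (fun=> 0) G = fun=> 0.
Proof.
apply/funext => x; apply/colP => j; rewrite mxE [RHS]mxE -[RHS](subrr 0).
congr (_ - _); first by rewrite /vact big1 // => i _; rewrite mxE mul0r.
rewrite -[RHS](vact_const G 0 x); congr (vact _ _ _).
by apply/funext => z; rewrite mxE.
Qed.

Lemma vlieN (R : realType) (m : nat) (F G : vfield R m) (x : 'cV[R]_m) :
  vlie F G x = - vlie G F x.
Proof. by apply/colP => j; rewrite !mxE opprB. Qed.

Lemma vlie0r (R : realType) (m : nat) (F : vfield R m) :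
  vlie F (fun=> 0) = fun=> 0.
Proof. by apply/funext => x; rewrite vlieN vlie0l oppr0. Qed.

Lemma vlie_self (R : realType) (m : nat) (F : vfield R m) : vlie F F = fun=> 0.
Proof. by apply/funext => x; apply/colP => j; rewrite !mxE subrr. Qed.

(** By induction both sides of a drift-only bracket are the drift or zero, and a field commutes with
    itself. *)
Lemma lie_eval_drift (R : realType) (m k : nat) (F0 : vfield R m)
    (F : 'I_k -> vfield R m) (w : lie_word k) :
  ~~ has_diffusion w -> w = LieGen None \/ lie_eval F0 F w = fun=> 0.
Proof.
elim: w => [[r|]|u IHu v IHv] //=; first by left.
rewrite negb_or => /andP[/IHu[->|->] /IHv[->|->]]; right.
- exact: vlie_self.
- exact: vlie0r.
- exact: vlie0l.
- exact: vlie0l.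
Qed.

(** Common form of [tbar] ([c = -1]) and [tlift] ([c = 0]). The time component is constant, hence
    lost in every bracket. *)
Definition tfield (R : realType) (n : nat) (c : R) (F : vfield R n)
  : vfield R (1 + n) := fun p => col_mx c%:M (F (dsubmx p)).

Lemma tbarE (R : realType) (n : nat) (F : vfield R n) : tbar F = tfield (-1) F.
Proof.
apply/funext => p; rewrite /tbar /ddt /tlift /tfield opp_col_mx add_col_mx.
by rewrite oppr0 add0r addr0 raddfN.
Qed.

Lemma tliftE (R : realType) (n : nat) (F : vfield R n) : tlift F = tfield 0 F.
Proof. by apply/funext => p; rewrite /tlift /tfield raddf0. Qed.

Lemma partial_time (R : realType) (n : nat) (h : 'cV[R]_n -> R) (i : 'I_1)
    (p : 'cV[R]_(1 + n)) : partial (lshift n i) (fun z => h (dsubmx z)) p = 0.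
Proof.
rewrite /partial /derive (_ : (fun _ => _) = fun=> 0); first exact: lim_cst.
apply/funext => s /=; set y := dsubmx (_ + _); have -> : y = dsubmx p.
  by apply/colP => j; rewrite !mxE eq_rlshift mulr0 add0r.
by rewrite subrr scaler0.
Qed.

Lemma vact_tfield (R : realType) (n : nat) (c : R) (F : vfield R n)
    (h : 'cV[R]_n -> R) (p : 'cV[R]_(1 + n)) :
  vact (tfield c F) (fun z => h (dsubmx z)) p = vact F h (dsubmx p).
Proof.
rewrite -[p in LHS]vsubmxK.
have -> : usubmx p = (usubmx p 0 0)%:M by rewrite -mx11_scalar.
transitivity (vact (tlift F) (fun z => h (dsubmx z))
  (tpoint (usubmx p 0 0) (dsubmx p))).
  rewrite /vact !big_split_ord /=; congr (_ + _).
    by rewrite !big1 // => i _; rewrite partial_time mulr0.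
  by apply: eq_bigr => i _; rewrite /tfield /tlift !col_mxEd.
rewrite vact_tlift; congr (vact _ _ _).
by apply/funext => z; rewrite /tpoint col_mxKd.
Qed.

Lemma vlie_tfield (R : realType) (n : nat) (c d : R) (F G : vfield R n) :
  vlie (tfield c F) (tfield d G) = tfield 0 (vlie F G).
Proof.
have tu (b : R) (H : vfield R n) (i : 'I_1) :
    (fun z => tfield b H z (lshift n i) 0) = fun=> b.
  by apply/funext => z; rewrite /tfield col_mxEu !ord1 mxE mulr1n.
have td (b : R) (H : vfield R n) (i : 'I_n) :
    (fun z => tfield b H z (rshift 1 i) 0) = fun z => H (dsubmx z) i 0.
  by apply/funext => z; rewrite /tfield col_mxEd.
apply/funext => p; apply/colP => i; rewrite mxE.
have [j ->|j ->] := split_ordP i.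
  by rewrite !tu !vact_const subrr /tfield col_mxEu raddf0 mxE.
rewrite !td (vact_tfield c F (fun z => G z j 0)) (vact_tfield d G (fun z => F z j 0)).
by rewrite /tfield col_mxEd mxE.
Qed.

Lemma lie_eval_time (R : realType) (n k : nat) (F0 : vfield R n)
    (F : 'I_k -> vfield R n) (w : lie_word k) :
  lie_eval (tbar F0) (fun r => tlift (F r)) w =
  tfield (if w is LieGen None then -1 else 0) (lie_eval F0 F w).
Proof.
elim: w => [[r|]|u IHu v IHv] /=; [exact: tliftE|exact: tbarE|].
by rewrite IHu IHv vlie_tfield.
Qed.

(** Words with a diffusion field give a copy of the ideal span with time component 0. Of the
    remaining words only the drift itself is nonzero, and its time component [-1] makes it
    transverse to that copy. *)
Lemma dim_Lie_span_time (R : realType) (n k : nat) (F0 : vfield R n)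
    (F : 'I_k -> vfield R n) (t : R) (x : 'cV[R]_n) :
  \dim (Lie_span (tbar F0) (fun r => tlift (F r)) (tpoint t x)) =
  (\dim (Lie_ideal_span F0 F x)).+1.
Proof.
pose v : 'cV[R]_(1 + n) := col_mx (-1)%:M (F0 x).
pose emb : 'Hom('cV[R]_n, 'cV[R]_(1 + n)) :=
  linfun (mulmx (col_mx (0 : 'M[R]_(1, n)) 1%:M)).
have embE u : emb u = col_mx 0 u by rewrite lfunE /= mul_col_mx mul0mx mul1mx.
have -> : Lie_span (tbar F0) (fun r => tlift (F r)) (tpoint t x) =
    (<[v]> + emb @: Lie_ideal_span F0 F x)%VS.
  apply/eqP; rewrite eqEsubv; apply/andP; split.
    apply: lin_span_sub => _ [w _ <-]; rewrite lie_eval_time /tfield /tpoint col_mxKd.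
    have [wd|/(lie_eval_drift F0 F)] := boolP (has_diffusion w).
      have -> : (if w is LieGen None then -1 else 0) = 0 :> R by case: w wd => [[]|].
      rewrite raddf0 -embE; apply: (subvP (addvSr _ _)); apply: memv_img.
      by apply: mem_lin_span; exists w.
    case=> [->|w0]; first by apply: (subvP (addvSl _ _)); exact: memv_line.
    case: w w0 => [[r|]|u1 u2] /= w0; last by rewrite w0 raddf0 col_mx0 mem0v.
      by rewrite w0 raddf0 col_mx0 mem0v.
    by apply: (subvP (addvSl _ _)); exact: memv_line.
  rewrite subv_add; apply/andP; split.
    apply: mem_lin_span; exists (LieGen None) => //.
    by rewrite lie_eval_time /tfield /tpoint col_mxKd.
  apply/subvP => _ /memv_imgP[u uS ->]; rewrite memv_preim; move: u uS.
  apply/subvP/lin_span_sub => _ [w wd <-]; rewrite -memv_preim embE.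
  apply: mem_lin_span; exists w => //.
  rewrite lie_eval_time /tfield /tpoint col_mxKd.
  by case: w wd => [[r|]|u1 u2] //= _; rewrite raddf0.
(* Compare time components: [- a] for [a *: v], and 0 in the embedded space. *)
have vC : (<[v]> :&: (emb @: Lie_ideal_span F0 F x))%VS = 0%VS.
  apply/eqP; rewrite -subv0; apply/subvP => _ /memv_capP[/vlineP[a ->]].
  move=> /memv_imgP[u _]; rewrite embE /v scale_col_mx => /eq_col_mx[+ _].
  move/matrixP/(_ 0 0); rewrite !mxE mulr1n mulrN1 => /eqP.
  by rewrite oppr_eq0 => /eqP ->; rewrite !scale0r col_mx0 mem0v.
rewrite dimv_disjoint_sum // dim_vline limg_dim_eq.
  suff -> : v != 0 by [].
  apply/eqP => /matrixP/(_ (lshift n 0) 0); rewrite /v col_mxEu !mxE => /eqP.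
  by rewrite mulr1n oppr_eq0 oner_eq0.
apply/eqP; rewrite -subv0; apply/subvP => u /memv_capP[_].
rewrite memv_ker embE => /eqP/(congr1 dsubmx); rewrite col_mxKd raddf0 => ->.
exact: mem0v.
Qed.

Lemma hormander_time (R : realType) (n k : nat) (L : hop R n k) :
  hormander (time_domain R n) (minus_dt_plus L) <->
  forall x, pos_orthant R n x ->
    \dim (Lie_ideal_span (drift L) (diffusion L) x) = n.
Proof.
have dimf : \dim {: 'cV[R]_(1 + n)} = n.+1 by rewrite dimvf /dim /= muln1.
split=> [LH x xp|LH _ [t _ [x xp <-]]].
  have := congr1 (fun U => \dim U) (LH (tpoint 0 x) _).
  rewrite dim_Lie_span_time dimf => H; apply: succn_inj; apply: H.
  by exists 0 => //; exists x.
by apply/eqP; rewrite eqEdim subvf dimf /= dim_Lie_span_time LH.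
Qed.

(** * Bounds of the ideal span by rescaled column spaces *)

Lemma diagvE (R : realType) (n : nat) (phi v : 'cV[R]_n) (j : 'I_n) :
  diagv phi v j 0 = phi j 0 * v j 0.
Proof. by rewrite lfunE /= mul_diag_mx !mxE. Qed.

Lemma dim_diagv (R : realType) (n : nat) (phi : 'cV[R]_n) (U : {vspace 'cV[R]_n}) :
  pos_orthant R n phi -> \dim (diagv phi @: U) = \dim U.
Proof.
move=> phip; apply: limg_dim_eq; apply/eqP; rewrite -subv0.
apply/subvP => u /memv_capP[_]; rewrite memv_ker => /eqP u0.
suff -> : u = 0 by exact: mem0v.
apply/colP => j; move/colP/(_ j): u0; rewrite diagvE !mxE => /eqP.
by rewrite mulf_eq0 gt_eqF ?phip //= => /eqP.
Qed.

(** Words with a diffusion field have no [e] part, so in the frame their values are combinations of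
    the columns of [M]. *)
Lemma Lie_ideal_span_sub (R : realType) (n k p : nat) (M : 'M[R]_(n, p))
    (e : 'I_n -> R) (F0 : vfield R n) (F : 'I_k -> vfield R n) (phi : 'cV[R]_n) :
  spanned M e 1 F0 -> (forall r, spanned M e 0 (F r)) -> pos_orthant R n phi ->
  (Lie_ideal_span F0 F phi <= diagv phi @: colsp M)%VS.
Proof.
move=> F0M FM phip; apply: lin_span_sub => _ [w wd <-].
have [d [f _ fE] /(_ wd) d0] := spanned_lie_eval w F0M FM.
apply/memv_imgP; exists (M *m \col_s f s phi); first exact: mem_colsp.
apply/colP => j; rewrite diagvE fE // d0 mul0r addr0 mxE.
by congr (_ * _); apply: eq_bigr => s _; rewrite mxE.
Qed.

Lemma diagv_colsp_sub (R : realType) (n p : nat) (M : 'M[R]_(n, p))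
    (phi : 'cV[R]_n) (U : {vspace 'cV[R]_n}) :
  (forall s, diagv phi (col s M) \in U) -> (diagv phi @: colsp M <= U)%VS.
Proof.
move=> MU; rewrite /colsp limg_span; apply/span_subvP => _ /mapP[_ /mapP[s _ ->] ->].
exact: MU.
Qed.

(** * Frame coefficients and weights of the given fields *)

Lemma vact_coord (R : realType) (n : nat) (F : vfield R n) (l : 'I_n)
    (x : 'cV[R]_n) : vact F (fun z => z l 0) x = F x l 0.
Proof.
rewrite /vact (bigD1 l) //= big1 ?addr0 => [|i il].
  by rewrite /partial (@derive_val _ _ _ _ _ _ _ (is_derive_coord _ _ _)) mxE !eqxx mulr1.
rewrite /partial (@derive_val _ _ _ _ _ _ _ (is_derive_coord _ _ _)) mxE.
by rewrite eq_sym (negPf il) mulr0.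
Qed.

Lemma vactM (R : realType) (n : nat) (F : vfield R n) (f g : 'cV[R]_n -> R)
    (x : 'cV[R]_n) : pos_orthant R n x -> smooth f -> smooth g ->
  vact F (fun z => f z * g z) x = vact F f x * g x + f x * vact F g x.
Proof.
move=> xp fS gS; rewrite /vact mulr_suml mulr_sumr -big_split.
apply: eq_bigr => i _ /=; rewrite /partial deriveM; try exact: smooth_derivable.
rewrite /= -![_ *: _]/(_ * _); ring.
Qed.

Lemma vactV (R : realType) (n : nat) (F : vfield R n) (f : 'cV[R]_n -> R)
    (x : 'cV[R]_n) : pos_orthant R n x -> smooth f -> f x != 0 ->
  vact F (fun z => (f z)^-1) x = - (f x) ^- 2 * vact F f x.
Proof.
move=> xp fS fx0; rewrite /vact mulr_sumr; apply: eq_bigr => i _.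
rewrite /partial deriveV //; last exact: smooth_derivable.
by rewrite mulrCA.
Qed.

Lemma smooth_ext (R : realType) (n : nat) (p : 'I_n.+1) :
  smooth (fun x : 'cV[R]_n => ext x p).
Proof. by rewrite /ext; case: unlift => [j|]; constructor. Qed.

Lemma ext_gt0 (R : realType) (n : nat) (p : 'I_n.+1) (x : 'cV[R]_n) :
  pos_orthant R n x -> 0 < ext x p.
Proof. by move=> xp; rewrite /ext; case: unlift. Qed.

(* The field with coefficients [jump (p, j)] in the frame [x_l d/dx_l] is
   [phi_p d/dphi_j] if [j > 0], and [- phi_p] times the Euler field if [j = 0]. *)
Definition jump (R : realType) (n : nat) (pj : 'I_n.+1 * 'I_n.+1) (l : 'I_n)
    (x : 'cV[R]_n) : R :=
  ext x pj.1 * ((pj.2 == lift ord0 l)%:R * (x l 0)^-1 + - (pj.2 == ord0)%:R).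

Definition weight (R : realType) (n k : nat) (lam : 'I_n.+1 -> 'cV[R]_k) (r : 'I_k)
    (pj : 'I_n.+1 * 'I_n.+1) : R :=
  shifted lam pj.1 r 0 - shifted lam pj.2 r 0.

Lemma smooth_coordV (R : realType) (n : nat) (l : 'I_n) :
  smooth (fun x : 'cV[R]_n => (x l 0)^-1).
Proof.
by apply: SmoothV; [exact: SmoothCoord | move=> x xp; rewrite gt_eqF ?xp].
Qed.

Lemma smooth_jump (R : realType) (n : nat) pj l : smooth (@jump R n pj l).
Proof.
apply: SmoothM; first exact: smooth_ext.
apply: SmoothD; last exact: SmoothCst.
by apply: SmoothM; [exact: SmoothCst|exact: smooth_coordV].
Qed.

Lemma shifted0 (R : realType) (n k : nat) (lam : 'I_n.+1 -> 'cV[R]_k) :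
  shifted lam ord0 = 0.
Proof. exact: subrr. Qed.

Lemma vact_ext (R : realType) (n k : nat) (lam : 'I_n.+1 -> 'cV[R]_k) (r : 'I_k)
    (p : 'I_n.+1) (x : 'cV[R]_n) :
  vact (Dfield lam r) (fun z => ext z p) x = shifted lam p r 0 * ext x p.
Proof.
rewrite /ext; case: unliftP => [j ->|->]; first by rewrite vact_coord mxE.
by rewrite vact_const shifted0 mxE mul0r.
Qed.

(** D_r scales phi_p by a_pr and phi_j^-1 by - a_jr. For [j = 0] the second factor is the constant
    [-1], and the formula persists because a_0 = 0. *)
Lemma vact_jump (R : realType) (n k : nat) (lam : 'I_n.+1 -> 'cV[R]_k) (r : 'I_k)
    (pj : 'I_n.+1 * 'I_n.+1) (l : 'I_n) (x : 'cV[R]_n) : pos_orthant R n x ->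
  vact (Dfield lam r) (jump pj l) x = weight lam r pj * jump pj l x.
Proof.
move=> xp; case: pj => p j.
have VS := @smooth_coordV R n l; have ES := @smooth_ext R n p.
have CVS (c : R) : smooth (fun x : 'cV[R]_n => c * (x l 0)^-1).
  by apply: SmoothM; [exact: SmoothCst|].
have xl0 : x l 0 != 0 by rewrite gt_eqF ?xp.
rewrite /jump vactM //; last by apply: SmoothD (SmoothCst _ _).
rewrite vactD //; last exact: SmoothCst.
rewrite vactM //; last exact: SmoothCst.
rewrite !vact_const vactV //; last exact: SmoothCoord.
have s0 : shifted lam ord0 r 0 = 0 by rewrite shifted0 mxE.
have -> : vact (Dfield lam r) (fun z => z l 0) x =
    shifted lam (lift ord0 l) r 0 * x l 0 by rewrite vact_coord mxE.
rewrite vact_ext /weight /=.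
have [->|_] := eqVneq j ord0.
  by rewrite (negPf (neq_lift _ _)) s0 /=; ring.
by have [->|_] := eqVneq j (lift ord0 l) => /=; field.
Qed.

(** Component [s] of the mean of a_0, ..., a_n under the probability weights [ext x i / ysum x]; the
    term of index 0 vanishes since a_0 = 0. *)
Definition bvec (R : realType) (n k : nat) (lam : 'I_n.+1 -> 'cV[R]_k) (s : 'I_k)
    (x : 'cV[R]_n) : R :=
  (ysum x)^-1 * \sum_(i < n) shifted lam (lift ord0 i) s 0 * x i 0.

Lemma smooth_bvec (R : realType) (n k : nat) (lam : 'I_n.+1 -> 'cV[R]_k) s :
  smooth (bvec lam s).
Proof.
apply: SmoothM; last by apply: smooth_lincomb => i; exact: SmoothCoord.
apply: SmoothV => [|x xp].
  by apply: SmoothD (SmoothCst _ _) _; apply: smooth_sum => i; exact: SmoothCoord.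
by rewrite gt_eqF // /ysum ltr_wpDr // sumr_ge0 // => i _; exact/ltW/xp.
Qed.

Definition drift_const (R : realType) (n k : nat) (lam : 'I_n.+1 -> 'cV[R]_k)
  (j : 'I_n) : R :=
  - (2^-1 * dotv (shifted lam (lift ord0 j)) (shifted lam (lift ord0 j))).

Lemma AmxTE (R : realType) (n k : nat) (lam : 'I_n.+1 -> 'cV[R]_k) (j : 'I_n)
    (s : 'I_k) : (Amx lam)^T j s = shifted lam (lift ord0 j) s 0.
Proof. by rewrite mxE [LHS]mxE. Qed.

(** Sigma_ij is the sum over [s] of a_is a_js, so the quadratic term of D_0 is the combination of
    the D_s with coefficients [bvec lam s]. The rest is constant in the frame. *)
Lemma D0fieldE (R : realType) (n k : nat) (lam : 'I_n.+1 -> 'cV[R]_k)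
    (x : 'cV[R]_n) (j : 'I_n) :
  D0field lam x j 0 =
  x j 0 * (\sum_s (Amx lam)^T j s * bvec lam s x + drift_const lam j).
Proof.
rewrite mxE /bvec /drift_const mulrDr; congr (_ + _); last ring.
rewrite mulr_sumr; under [RHS]eq_bigr do rewrite AmxTE !mulr_sumr.
rewrite exchange_big mulr_sumr; apply: eq_bigr => i _ /=.
rewrite /Sigma /dotv !mulr_suml mulr_sumr; apply: eq_bigr => s _; ring.
Qed.

Lemma JfieldE (R : realType) (n : nat) (q : 'M[R]_n.+1) (x : 'cV[R]_n) (j : 'I_n) :
  pos_orthant R n x ->
  Jfield q x j 0 = x j 0 * \sum_i q i.1 i.2 * jump i j x.
Proof.
move=> xp; have xj0 : x j 0 != 0 by rewrite gt_eqF ?xp.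
rewrite mxE -(pair_bigA _ (fun p l => q p l * jump (p, l) j x)) /= mulr_sumr.
apply: eq_bigr => p _.
(* For fixed [p] only the pairs [(p, ord0)] and [(p, lift ord0 j)] contribute to component [j]. *)
rewrite big_ord_recl (bigD1 j) //= big1 => [|l /negPf lj]; rewrite /jump /=.
  by rewrite !eqxx /=; field.
by rewrite (inj_eq lift_inj) lj /=; ring.
Qed.

Lemma D0JfieldE (R : realType) (n k : nat) (q : 'M[R]_n.+1)
    (lam : 'I_n.+1 -> 'cV[R]_k) (x : 'cV[R]_n) (j : 'I_n) : pos_orthant R n x ->
  D0Jfield q lam x j 0 = x j 0 *
    (\sum_s (Amx lam)^T j s * bvec lam s x +
      (\sum_i q i.1 i.2 * jump i j x + drift_const lam j)).
Proof. by move=> xp; rewrite mxE D0fieldE JfieldE //; ring. Qed.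

Lemma DfieldE (R : realType) (n k : nat) (lam : 'I_n.+1 -> 'cV[R]_k)
    (r : 'I_k) (x : 'cV[R]_n) :
  Dfield lam r x = diagv x (col r (Amx lam)^T).
Proof. by apply/colP => j; rewrite diagvE !mxE mulrC. Qed.

Lemma Dfield_Hspace (R : realType) (n k : nat) (q : 'M[R]_n.+1)
    (lam : 'I_n.+1 -> 'cV[R]_k) (r : 'I_k) (x : 'cV[R]_n) :
  diagv x (col r (Amx lam)^T) \in Hspace q lam x.
Proof. by rewrite -DfieldE; apply: mem_lin_span; exists (LieGen (Some r)). Qed.

Definition jumpv (R : realType) (n : nat) (pj : 'I_n.+1 * 'I_n.+1)
    (x : 'cV[R]_n) : 'cV[R]_n := diagv x (\col_l jump pj l x).

(* Value of the iterated bracket of [D_r], [r] in [rs], with the drift,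
   modulo the span of the [D_r]. *)
Lemma ad_jump_Hspace (R : realType) (n k : nat) (q : 'M[R]_n.+1)
    (lam : 'I_n.+1 -> 'cV[R]_k) (rs : seq 'I_k) (x : 'cV[R]_n) :
  pos_orthant R n x -> rs != [::] ->
  \sum_i (q i.1 i.2 * \prod_(r <- rs) weight lam r i) *: jumpv i x
    \in Hspace q lam x.
Proof.
move=> xp rs0.
have [|||||g _ gE] := @lie_eval_ad R n k _ (Amx lam)^T (drift_const lam)
  (@jump R n) (weight lam) (fun i => q i.1 i.2) (bvec lam) (D0Jfield q lam)
  (Dfield lam) _ _ _ _ _ rs.
- exact: smooth_jump.
- exact: smooth_bvec.
- by move=> z j; exact: D0JfieldE.
- by move=> r z j _; rewrite DfieldE diagvE mxE.
- by move=> r i j z; exact: vact_jump.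
set v := \sum_i _; pose w := \sum_s g s x *: diagv x (col s (Amx lam)^T).
have E : lie_eval (D0Jfield q lam) (Dfield lam) (ad_word rs) x = w + v.
  apply/colP => j; rewrite gE // (negPf rs0) mul0r addr0 [RHS]mxE mulrDr.
  congr (_ + _); rewrite summxE mulr_sumr; apply: eq_bigr => s _.
    by rewrite [RHS]mxE diagvE [in RHS]mxE; ring.
  by rewrite [RHS]mxE /jumpv diagvE [in RHS]mxE; ring.
(* The bracket and its part [w] along the D_r both lie in [Hspace], hence so does the difference
   [v]. *)
rewrite -(addKr w v) -E rpredD // ?rpredN.
  by apply: rpred_sum => s _; apply: rpredZ; exact: Dfield_Hspace.
by apply: mem_lin_span; exists (ad_word rs) => //; exact: has_diffusion_ad.
Qed.

(** * The bracket space in cases (1) and (3) *)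

Lemma spanned_Dfield (R : realType) (n k p : nat) (lam : 'I_n.+1 -> 'cV[R]_k)
    (M : 'M[R]_(n, p)) (e : 'I_n -> R) (r : 'I_k) (s0 : 'I_p) :
  (forall j, M j s0 = (Amx lam)^T j r) -> spanned M e 0 (Dfield lam r).
Proof.
move=> Ms0; exists (fun s _ => (s == s0)%:R) => [s|x j _]; first exact: SmoothCst.
rewrite DfieldE diagvE mxE mul0r addr0 (bigD1 s0) //= eqxx mulr1 -Ms0.
by rewrite big1 ?addr0 // => s /negPf ->; rewrite mulr0.
Qed.

(** Without jumps the drift is [drift_const] plus a combination of the columns of A^T, so the upper
    bound applies with A^T; the D_r alone attain it. *)
Lemma Hspace_q0 (R : realType) (n k : nat) (lam : 'I_n.+1 -> 'cV[R]_k)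
    (phi : 'cV[R]_n) : pos_orthant R n phi ->
  Hspace 0 lam phi = (diagv phi @: colsp (Amx lam)^T)%VS.
Proof.
move=> phip; apply/eqP; rewrite eqEsubv; apply/andP; split; last first.
  by apply: diagv_colsp_sub => r; exact: Dfield_Hspace.
apply: (Lie_ideal_span_sub (e := drift_const lam)) => //; last first.
  by move=> r; exact: spanned_Dfield.
exists (bvec lam) => [s|x j xp]; first exact: smooth_bvec.
rewrite D0JfieldE // mul1r [X in _ + (X + _)]big1 ?add0r // => i _.
by rewrite mxE mul0r.
Qed.

(** For pairs [(p, ord0)] the coefficient [- ext x p] is independent of [j]: a multiple of the Euler
    field. Of the other pairs only the diagonal survives, where phi_j cancels phi_j^-1. The factor
    [c] is 1 for the drift and a squared weight for double brackets. *)
Lemma sum_jump_diag (R : realType) (n : nat) (q : 'M[R]_n.+1)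
    (c : 'I_n.+1 * 'I_n.+1 -> R) (j : 'I_n) (x : 'cV[R]_n) :
  (forall j : 'I_n.+1, j != ord0 -> forall m : 'I_n.+1, m != j -> q m j = 0) ->
  pos_orthant R n x ->
  \sum_i q i.1 i.2 * c i * jump i j x =
  - \sum_p q p ord0 * c (p, ord0) * ext x p
  + q (lift ord0 j) (lift ord0 j) * c (lift ord0 j, lift ord0 j).
Proof.
move=> q_off xp; have xj0 : x j 0 != 0 by rewrite gt_eqF ?xp.
rewrite (eq_bigr (fun i => q i.1 i.2 * c (i.1, i.2) * jump (i.1, i.2) j x));
  last by case.
rewrite -(pair_bigA _ (fun p l => q p l * c (p, l) * jump (p, l) j x)) /=.
under eq_bigr do rewrite big_ord_recl.
rewrite big_split /= -sumrN; congr (_ + _).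
  by apply: eq_bigr => p _; rewrite /jump /=; ring.
have neq_j l p : l != j -> q p (lift ord0 l) * c (p, lift ord0 l) *
    jump (p, lift ord0 l) j x = 0.
  by move=> /negPf lj; rewrite /jump (inj_eq lift_inj) lj /=; ring.
rewrite (bigD1 (lift ord0 j)) //= [X in _ + X]big1 ?addr0 => [|p pj]; last first.
  apply: big1 => l _; have [lj|lj] := eqVneq l j; last exact: neq_j.
  by rewrite lj q_off // !mul0r.
rewrite (bigD1 j) //= big1 ?addr0 => [|l lj]; last exact: neq_j.
by rewrite /jump eqxx /ext liftK /=; field.
Qed.

Lemma Hspace_no_off_sub (R : realType) (n k : nat) (q : 'M[R]_n.+1)
    (lam : 'I_n.+1 -> 'cV[R]_k) (phi : 'cV[R]_n) :
  (forall j : 'I_n.+1, j != ord0 -> forall m : 'I_n.+1, m != j -> q m j = 0) ->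
  pos_orthant R n phi ->
  (Hspace q lam phi <= diagv phi @: colsp (AT1 lam))%VS.
Proof.
move=> q_off phip.
apply: (Lie_ideal_span_sub
  (e := fun j => q (lift ord0 j) (lift ord0 j) + drift_const lam j)) => //;
  last first.
  move=> r; apply: (@spanned_Dfield _ _ _ _ _ _ _ _ (lshift 1 r)) => j.
  by rewrite /AT1 row_mxEl.
(* The all-ones column of [AT1 lam] carries the Euler part of J; the diagonal rates q_jj went into
   the constant vector [e]. *)
exists (fun s : 'I_(k + 1) => match fintype.split s with
  | inl s => bvec lam s
  | inr _ => fun x : 'cV[R]_n => \sum_p - q p ord0 * ext x p end).
  move=> s; case: fintype.split => [{}s|_]; first exact: smooth_bvec.
  by apply: smooth_lincomb => p; exact: smooth_ext.
move=> x j xp; rewrite D0JfieldE // big_split_ord big_ord1 /=; congr (_ * _).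
rewrite (unsplitK (inr _)) /AT1 row_mxEr mxE mul1r mul1r -!addrA; congr (_ + _).
  apply: eq_bigr => s _.
  by rewrite row_mxEl (unsplitK (inl _)).
under eq_bigr do rewrite -[q _ _]mulr1.
rewrite (sum_jump_diag (fun=> 1)) // mulr1 -sumrN addrCA addrA; congr (_ + _).
rewrite addrC; congr (_ + _).
by apply: eq_bigr => p _; rewrite mulr1 mulNr.
Qed.

(** Beyond the D_r only the Euler direction [phi] must be reached. Two brackets with the same D_r
    square the weights: diagonal jumps have weight 0 and vanish, and the others add up without
    cancellation to [- c *: phi] with [c > 0]. *)
Lemma Hspace_no_off (R : realType) (n k : nat) (q : 'M[R]_n.+1)
    (lam : 'I_n.+1 -> 'cV[R]_k) (phi : 'cV[R]_n) :
  generator q ->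
  (forall j : 'I_n.+1, j != ord0 -> forall m : 'I_n.+1, m != j -> q m j = 0) ->
  injective lam -> (exists2 j, j != ord0 & 0 < q j ord0) ->
  pos_orthant R n phi ->
  Hspace q lam phi = (diagv phi @: colsp (AT1 lam))%VS.
Proof.
move=> [q_ge0 _ _] q_off lamI [j0 j00 qj0] phip.
apply/eqP; rewrite eqEsubv Hspace_no_off_sub //=.
apply: diagv_colsp_sub => s; have [r ->|i ->] := split_ordP s.
  have -> : col (lshift 1 r) (AT1 lam) = col r (Amx lam)^T.
    by apply/colP => j; rewrite /AT1 !mxE (unsplitK (inl _)) !mxE.
  exact: Dfield_Hspace.
have [r r0] : exists r, shifted lam j0 r 0 != 0.
  apply: contra_notP (negP j00) => /forallNP rj0.
  apply/eqP/lamI/eqP; rewrite -subr_eq0; apply/eqP/colP => r.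
  by rewrite [RHS]mxE; apply/eqP; move/(_ r)/negP: rj0; rewrite negbK.
pose c := \sum_p q p ord0 *
  (weight lam r (p, ord0) * weight lam r (p, ord0)) * ext phi p.
have c_gt0 : 0 < c.
  rewrite /c (bigD1 j0) //=; apply: ltr_wpDr; last first.
    rewrite mulr_gt0 ?ext_gt0 // mulr_gt0 // -expr2 exprn_even_gt0 //=.
    by rewrite /weight /= shifted0 [X in _ - X]mxE subr0.
  apply: sumr_ge0 => p _; rewrite mulr_ge0 ?(ltW (ext_gt0 _ _)) //.
  (* The rate q_00, which may be negative, comes with weight 0. *)
  have [->|p0] := eqVneq p ord0; first by rewrite /weight /= subrr !mulr0.
  by rewrite mulr_ge0 ?q_ge0 // -expr2 sqr_ge0.
have := @ad_jump_Hspace _ _ _ q lam [:: r; r] phi phip isT.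
set v := \sum_i _; have -> : v = - c *: phi.
  apply/colP => j; rewrite summxE [RHS]mxE.
  transitivity (phi j 0 *
    \sum_i q i.1 i.2 * (weight lam r i * weight lam r i) * jump i j phi).
    rewrite mulr_sumr; apply: eq_bigr => i0 _.
    by rewrite [LHS]mxE /jumpv diagvE [X in _ * (_ * X)]mxE !big_cons big_nil; ring.
  rewrite (sum_jump_diag (fun i => weight lam r i * weight lam r i)) //.
  by rewrite {2 3}/weight /= subrr -/c; ring.
move=> cH; have -> : diagv phi (col (rshift k i) (AT1 lam)) = (- c)^-1 *: (- c *: phi).
  rewrite scalerA mulVf ?scale1r ?oppr_eq0 ?gt_eqF //.
  by apply/colP => j; rewrite diagvE /AT1 !mxE (unsplitK (inr _)) mxE mulr1.
exact: rpredZ.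
Qed.

(** * Separation of weights in case (2) *)

(* The factors kill all weights other than the selected ones. *)
Lemma ad_filter_Hspace (R : realType) (n k : nat) (q : 'M[R]_n.+1)
    (lam : 'I_n.+1 -> 'cV[R]_k) (r0 : 'I_k) (s : seq ('I_k * R))
    (rs : seq 'I_k) (x : 'cV[R]_n) : pos_orthant R n x ->
  \sum_i (q i.1 i.2 * (weight lam r0 i * \prod_(z <- s) (weight lam z.1 i - z.2)) *
    \prod_(r <- rs) weight lam r i) *: jumpv i x \in Hspace q lam x.
Proof.
move=> xp; elim: s rs => [|[r b] s IH] rs.
  (* The factor [weight lam r0] is a bracket with D_r0, which makes the word [r0 :: rs] nonempty. *)
  under eq_bigr do rewrite big_nil mulr1 -mulrA -(big_cons _ _ r0 rs xpredT).
  exact: ad_jump_Hspace.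
(* The factor [weight lam r i - b] is one more bracket with D_r minus [b] times the same sum; this
   is why [rs] is arbitrary in the induction. *)
rewrite (eq_bigr (fun i => (q i.1 i.2 * (weight lam r0 i *
    \prod_(z <- s) (weight lam z.1 i - z.2)) *
      \prod_(r' <- r :: rs) weight lam r' i) *: jumpv i x
  - b *: ((q i.1 i.2 * (weight lam r0 i *
    \prod_(z <- s) (weight lam z.1 i - z.2)) *
      \prod_(r' <- rs) weight lam r' i) *: jumpv i x))); last first.
  by move=> i _; rewrite scalerA -scalerBl !big_cons /=; congr (_ *: _); ring.
rewrite sumrB -scaler_sumr; apply: rpredB; first exact: IH.
by apply: rpredZ; exact: IH.
Qed.

Lemma jumpv_lift (R : realType) (n : nat) (p : 'I_n.+1) (l : 'I_n) (x : 'cV[R]_n) :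
  pos_orthant R n x -> jumpv (p, lift ord0 l) x = ext x p *: delta_mx l 0.
Proof.
move=> xp; apply/colP => j; rewrite diagvE !mxE /jump (inj_eq lift_inj) eqxx andbT /=.
have xj0 : x j 0 != 0 by rewrite gt_eqF ?xp.
by rewrite eq_sym; case: (j == l) => /=; field.
Qed.

Lemma shifted_weight_eq (R : realType) (n k : nat) (lam : 'I_n.+1 -> 'cV[R]_k)
    (p j m i : 'I_n.+1) :
  (forall r, weight lam r (p, j) = weight lam r (m, i)) ->
  shifted lam p - shifted lam j = shifted lam m - shifted lam i.
Proof.
move=> H; apply/colP => r.
have subE (u v : 'cV[R]_k) : (u - v) r 0 = u r 0 - v r 0 by rewrite !mxE.
exact: etrans (subE _ _) (etrans (H r) (esym (subE _ _))).
Qed.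

(** It suffices to reach each coordinate direction. A polynomial in the ad(D_r) that vanishes at all
    weights other than a_m - a_i is applied to the drift; by the separation hypothesis only the pair
    [(m, i)] survives, and its jump is a nonzero multiple of that direction. *)
Lemma Hspace_full (R : realType) (n k : nat) (q : 'M[R]_n.+1)
    (lam : 'I_n.+1 -> 'cV[R]_k) (phi : 'cV[R]_n) :
  generator q -> injective (shifted lam) ->
  (forall i : 'I_n.+1, i != ord0 ->
     exists m : 'I_n.+1, [/\ m != i, 0 < q m i &
       forall p j : 'I_n.+1, 0 < q p j ->
         shifted lam p - shifted lam j = shifted lam m - shifted lam i -> j = i]) ->
  pos_orthant R n phi -> Hspace q lam phi = fullv.
Proof.
move=> [q_ge0 _ _] aI sep phip.
suff deltaH l : delta_mx l 0 \in Hspace q lam phi.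
  apply/eqP; rewrite eqEsubv subvf; apply/subvP => v _.
  rewrite (matrix_sum_delta v); apply: rpred_sum => l _.
  by rewrite big_ord1; apply: rpredZ.
set i := lift ord0 l.
have [m [mi qmi sepi]] : exists m : 'I_n.+1, [/\ m != i, 0 < q m i &
       forall p j : 'I_n.+1, 0 < q p j ->
         shifted lam p - shifted lam j = shifted lam m - shifted lam i -> j = i].
  exact: sep.
have [r0 wr0] : exists r, weight lam r (m, i) != 0.
  apply: contra_notP (negP mi) => /forallNP w0.
  apply/eqP/aI/colP => r; apply/eqP; rewrite -subr_eq0.
  by move/(_ r)/negP: w0; rewrite negbK.
(* Each pair [zr.1] whose weight differs from that of [(m, i)] in component [zr.2] contributes that
   component as a root to [s]. *)
pose sepr zr := weight lam zr.2 zr.1 != weight lam zr.2 (m, i).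
pose s := [seq (zr.2, weight lam zr.2 zr.1)
  | zr <- enum {: ('I_n.+1 * 'I_n.+1) * 'I_k} & sepr zr].
pose c z := weight lam r0 z * \prod_(y <- s) (weight lam y.1 z - y.2).
have cE z : c z = weight lam r0 z *
    \prod_(zr | sepr zr) (weight lam zr.2 z - weight lam zr.2 zr.1).
  by rewrite /c /s big_map big_filter big_enum_cond.
have c0 : c (m, i) != 0.
  rewrite cE mulf_neq0 //; apply/prodf_neq0 => zr.
  by rewrite subr_eq0 eq_sym.
(* A different weight is killed by a factor of the product. At equal weight, [p = j] is killed by
   the weight 0, and for [p != j] separation leaves only a zero rate or the pair [(m, i)] itself. *)
have qc0 z : z != (m, i) -> q z.1 z.2 * c z = 0.
  case: z => p j zmi /=.
  have [w|/existsNP[r wr]] :=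
      pselect (forall r, weight lam r (p, j) = weight lam r (m, i)).
    have aE := shifted_weight_eq w.
    have [pj|pj] := eqVneq p j.
      rewrite cE [X in _ * (X * _)](_ : _ = 0) ?mul0r ?mulr0 //.
      by rewrite /weight /= pj subrr.
    have := q_ge0 _ _ pj; rewrite le_eqVlt => /predU1P[<-|qpj]; first exact: mul0r.
    have ji := sepi _ _ qpj aE; case/eqP: zmi; congr (_, _) => //.
    by apply: aI; move: aE; rewrite ji => /addIr.
  apply/eqP; rewrite cE !mulf_eq0; apply/orP; right; apply/orP; right.
  by apply/prodf_eq0; exists ((p, j), r); rewrite /sepr /= ?subrr //; apply/eqP.
have := ad_filter_Hspace q lam r0 s [::] phip.
rewrite (bigD1 (m, i)) //= [X in _ + X]big1 ?addr0 => [|z zmi]; last first.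
  by rewrite -/(c z) qc0 // mul0r scale0r.
rewrite -/(c (m, i)) big_nil mulr1 jumpv_lift // scalerA => H.
set a := _ * _ * _ in H.
have a0 : a != 0.
  apply: mulf_neq0; last by rewrite gt_eqF ?ext_gt0.
  by apply: mulf_neq0 => //; rewrite gt_eqF.
by rewrite -[delta_mx l 0]scale1r -(mulVf a0) -scalerA; exact: rpredZ.
Qed.

Theorem corollary5p2 (R : realType) (n k : nat) (q : 'M[R]_n.+1)
    (lam : 'I_n.+1 -> 'cV[R]_k)
    (k_ge1 : (1 <= k)%N) (k_lt_n : (k < n)%N)
    (q_generator : generator q)
    (lam_distinct : injective lam)
    (lam0_vertex : is_vertex (conv_hull lam) (lam ord0)) :
  (q = 0 ->
     (forall phi, pos_orthant R n phi ->
        \dim (Hspace q lam phi) = \rank (Amx lam) /\ (\rank (Amx lam) <= k < n)%N) /\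
     ~ hormander (time_domain R n) (minus_dt_plus (Lphi q lam))) /\
  (injective (shifted lam) ->
   (forall i : 'I_n.+1, i != ord0 ->
      exists m : 'I_n.+1, [/\ m != i, 0 < q m i &
        forall p j : 'I_n.+1, 0 < q p j ->
          shifted lam p - shifted lam j = shifted lam m - shifted lam i -> j = i]) ->
     (forall (t : R) (phi : 'cV[R]_n), pos_orthant R n phi ->
        \dim (Lie_span (tbar (D0Jfield q lam)) (fun r => tlift (Dfield lam r))
                (tpoint t phi)) = n.+1) /\
     hormander (time_domain R n) (minus_dt_plus (Lphi q lam))) /\
  ((forall j : 'I_n.+1, j != ord0 -> forall m : 'I_n.+1, m != j -> q m j = 0) ->
   (exists2 j : 'I_n.+1, j != ord0 & 0 < q j ord0) ->
     [/\ forall phi, pos_orthant R n phi ->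
           Hspace q lam phi = (diagv phi @: colsp (AT1 lam))%VS,
         n = k.+1 -> \rank (AT1 lam) = n ->
           hormander (time_domain R n) (minus_dt_plus (Lphi q lam)) &
         (k.+1 < n)%N ->
           ~ hormander (time_domain R n) (minus_dt_plus (Lphi q lam))]).
Proof.
(* Witness for both failures of the condition; any point serves, as the dimension is constant on the
   orthant. *)
have onep : pos_orthant R n (const_mx 1) by move=> j; rewrite mxE.
split; [move=> q0|split=> [aI sep|q_off q_pos]].
- have dimH phi : pos_orthant R n phi ->
      \dim (Hspace q lam phi) = \rank (Amx lam).
    by move=> phip; rewrite q0 Hspace_q0 // dim_diagv // dim_colsp mxrank_tr.
  split=> [phi phip|/hormander_time/(_ _ onep)].
    by rewrite dimH // rank_leq_row k_lt_n.
  rewrite dimH // => rkA; have := rank_leq_row (Amx lam).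
  by rewrite rkA leqNgt k_lt_n.
- have dimH phi : pos_orthant R n phi -> \dim (Hspace q lam phi) = n.
    by move=> phip; rewrite Hspace_full // dimvf /dim /= muln1.
  split=> [t phi phip|]; first by rewrite dim_Lie_span_time dimH.
  exact/hormander_time.
have HE phi : pos_orthant R n phi ->
    Hspace q lam phi = (diagv phi @: colsp (AT1 lam))%VS.
  exact: Hspace_no_off.
have dimH phi : pos_orthant R n phi ->
    \dim (Hspace q lam phi) = \rank (AT1 lam).
  by move=> phip; rewrite HE // dim_diagv // dim_colsp.
split=> // [_ rk|kn /hormander_time/(_ _ onep)].
  by apply/hormander_time => phi phip; rewrite dimH.
rewrite dimH // => rk; have := rank_leq_col (AT1 lam).
by rewrite rk addn1 leqNgt kn.
Qed.
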